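(* Let $\langle \mathcal{N},\mathcal{D},\theta\rangle$ be a $d$-dimensional sandpile model with complete neighborhood and let $r=\max\{|v|_\infty : v\in\mathcal{N}\}$. There is an absolute constant $K$ such that for every $n\ge1$ and every configuration $c$ supported on $\{0,\dots,n-1\}^d$ with $c(x)<2\theta$ for all $x$, the sequence $c,F(c),F^2(c),\dots$ reaches a stable configuration within at most $(2d\theta r n)^{K d^2}$ time steps (a polynomial in the size of $c$).
   Context: A $d$-dimensional sandpile model is a triple $\langle \mathcal{N},\mathcal{D},\theta\rangle$ with $\mathcal{N}$ a finite subset of $\mathbb{Z}^d\setminus\{0^d\}$, $\mathcal{D}:\mathcal{N}\to\mathbb{N}_+$, $\theta=\sum_{v\in\mathcal{N}}\mathcal{D}(v)$; completeness means that nonnegative integer linear combinations of elements of $\mathcal{N}$ give all of $\mathbb{Z}^d$. Configurations are maps $c:\mathbb{Z}^d\to\mathbb{N}$. The global rule is $F(c)(x)=c(x)-\theta\,H(c(x)-\theta)+\sum_{v\in\mathcal{N}}\mathcal{D}(v)H(c(x+v)-\theta)$ where $H(m)=1$ if $m\ge0$ and $0$ otherwise. A configuration is stable if $c(x)<\theta$ for all $x$ (stable configurations are fixed points of $F$). *)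

(* Defs.v *)
From mathcomp Require Import all_boot all_order all_algebra.
From mathcomp Require Import finmap.

Set Implicit Arguments.
Unset Strict Implicit.
Unset Printing Implicit Defensive.

Import Order.TTheory GRing.Theory Num.Theory.
Local Open Scope ring_scope.

Record sandpile (d : nat) := Sandpile {
  nbh : {fset 'rV[int]_d};
  nbh_neq0 : 0 \notin nbh;
  distr : nbh -> nat;
  distr_gt0 : forall v : nbh, (0 < distr v)%N
}.

Definition configuration (d : nat) := 'rV[int]_d -> nat.

Definition theta (d : nat) (M : sandpile d) : nat :=
  (\sum_(v : nbh M) distr v)%N.

Definition complete (d : nat) (M : sandpile d) : Prop :=
  forall x : 'rV[int]_d,
    exists a : nbh M -> nat, x = \sum_(v : nbh M) val v *+ a v.

Definition norm_inf (d : nat) (x : 'rV[int]_d) : nat :=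
  (\max_(i < d) `|x ord0 i|)%N.

Definition radius (d : nat) (M : sandpile d) : nat :=
  (\max_(v : nbh M) norm_inf (val v))%N.

Definition heaviside (m : int) : nat := if 0 <= m then 1%N else 0%N.

(* The natural-number subtraction never truncates: the factor [heaviside _]
   vanishes unless [theta M <= c x]. *)
Definition global_rule (d : nat) (M : sandpile d) (c : configuration d) :
    configuration d :=
  fun x =>
    (c x - theta M * heaviside ((c x)%:Z - (theta M)%:Z)
     + \sum_(v : nbh M)
         distr v * heaviside ((c (x + val v)%R)%:Z - (theta M)%:Z))%N.

Definition stable (d : nat) (M : sandpile d) (c : configuration d) : Prop :=
  forall x, (c x < theta M)%N.

Definition supported_on_cube (d n : nat) (c : configuration d) : Prop :=
  forall x, c x <> 0%N -> forall i : 'I_d, 0 <= x ord0 i < n%:Z.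

(* Main.v *)
(**
A linear relation [sum a_v v = 0] with [a_v >= 0] can be walked through in an
order in which every partial count stays proportional to [a_v] up to a bounded
error, so that the walk stays within distance [2 theta r] of its start. Suppose
that [x] has toppled before time [t] and follow such a walk from [x]: a visited
site which holds no grain at time [t] must have toppled after the previous site of
the walk sent it a grain. Toppling times cannot increase forever, so at time [t]
there is a grain within distance [2 theta r] of [x].

Grains leave the cube by steps of length at most [r], hence a grain far away forces
a toppled site, and then a grain, in each of many disjoint shells. As the number
[N] of grains is preserved, all grains stay within a distance polynomial in [N].

Finally, some potential (linear, or the squared norm if the drift vanishes)
increases by at least 1 with each toppling while remaining polynomially bounded;
this bounds the number of topplings, hence of steps before stability.
*)
Require Import Defs.
From mathcomp Require Import all_boot all_order all_algebra.
From mathcomp Require Import finmap zify ring.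

Set Implicit Arguments.
Unset Strict Implicit.
Unset Printing Implicit Defensive.

Import Order.TTheory GRing.Theory Num.Theory.

Lemma int_mulrr_ge1 (z : int) : z != 0%R -> (1 <= z * z)%R.
Proof. by nia. Qed.

(** * The maximum norm on integer vectors *)

Section NormInf.
Local Open Scope ring_scope.
Variable d : nat.
Implicit Types x y : 'rV[int]_d.

(* Restated at type [int] so that [lia] sees [fun_of_matrix] at that type. *)
Lemma int_rowD x y i : (x + y) ord0 i = x ord0 i + y ord0 i :> int.
Proof. exact: mxE. Qed.

Lemma int_rowB x y i : (x - y) ord0 i = x ord0 i - y ord0 i :> int.
Proof. by rewrite !mxE. Qed.

Lemma norm_inf_leP x b :
  reflect (forall i, (`|x ord0 i| <= b)%N) (norm_inf x <= b)%N.
Proof. by apply: (iffP (bigmax_leqP _ _ _)) => [h i|h i _]; apply: h. Qed.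

Lemma norm_inf_ge x i : (`|x ord0 i| <= norm_inf x)%N.
Proof. exact/norm_inf_leP. Qed.

Lemma norm_infN x : norm_inf (- x) = norm_inf x.
Proof. by apply: eq_bigr => i _; rewrite mxE abszN. Qed.

Lemma norm_infD x y : (norm_inf (x + y) <= norm_inf x + norm_inf y)%N.
Proof.
apply/norm_inf_leP => i; rewrite int_rowD.
by have := norm_inf_ge x i; have := norm_inf_ge y i; lia.
Qed.

End NormInf.

(** * The toppling rule and its elementary consequences *)

Section Toppling.
Local Open Scope ring_scope.
Variables (d : nat) (M : sandpile d).
Implicit Types (c : configuration d) (x y : 'rV[int]_d) (v w : nbh M).
Local Notation R := (2 * theta M * radius M)%N.

Definition topples c x : bool := (theta M <= c x)%N.

Lemma global_ruleE c x :
  global_rule M c x = (c x - theta M * topples c x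
     + \sum_(v : nbh M) distr v * topples c (x + val v)%R)%N.
Proof.
have hE (m : nat) : heaviside (m%:Z - (theta M)%:Z) = (theta M <= m)%N.
  by rewrite /heaviside subr_ge0 lez_nat; case: leq.
rewrite /global_rule hE; congr addn.
by apply: eq_bigr => v _; rewrite hE.
Qed.

Lemma radius_ge v : (norm_inf (val v) <= radius M)%N.
Proof. exact: (@leq_bigmax _ (fun v : nbh M => norm_inf (val v))). Qed.

Lemma card_nbh_le : (#|{: nbh M}| <= theta M)%N.
Proof.
rewrite -sum1_card /theta; apply: leq_sum => v _; exact: distr_gt0.
Qed.

Lemma global_rule_ge c x : ~~ topples c x -> (c x <= global_rule M c x)%N.
Proof. by move=> /negbTE h; rewrite global_ruleE h muln0 subn0 leq_addr. Qed.

Lemma global_rule_gt0 c x v : topples c x -> (0 < global_rule M c (x - val v)%R)%N.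
Proof.
move=> h; rewrite global_ruleE (bigD1 v) //= subrK h muln1.
by have := distr_gt0 v; lia.
Qed.

(** Completeness expresses [- v0] as a combination of neighbors, and adding [v0] closes the loop. A
    neighbor [v0] exists because the all-ones vector is not an empty sum when [d] is positive. *)
Lemma complete_relation : (0 < d)%N -> complete M ->
  exists2 a : nbh M -> nat, (0 < \sum_v a v)%N & \sum_v val v *+ a v = 0.
Proof.
move=> d0 cM; have [v0|nb0] := pickP (fun _ : nbh M => true).
  move=> _; have [a ha] := cM (- val v0).
  exists (fun v => (a v + (v == v0))%N).
    by rewrite (bigD1 v0) //= eqxx; lia.
  under eq_bigr do rewrite mulrnDr.
  rewrite big_split /= -ha (bigD1 v0) //= eqxx mulr1n big1 ?addr0 ?addNr //.
  by move=> v /negbTE ->; rewrite mulr0n.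
have [a] := cM (const_mx 1).
rewrite big1 => [|v _]; last by have := nb0 v.
by move/rowP/(_ (Ordinal d0)); rewrite !mxE.
Qed.

(** * Balanced walks along a closed relation *)

Section Walk.
Variable a : nbh M -> nat.
Local Notation A := (\sum_v a v)%N.
Hypothesis A_gt0 : (0 < A)%N.
Hypothesis a_rel : \sum_v val v *+ a v = 0.

(* [k v] counts the steps [v] among the first [i] steps of the walk; its excess over
   the ideal count [i * a v / A] stays below 1. *)
Definition balanced (i : nat) (k : nbh M -> nat) : Prop :=
  (\sum_v k v)%N = i /\ forall v, (A * k v < i * a v + A)%N.

Lemma balanced0 : balanced 0 (fun=> 0%N).
Proof. by split=> [|v]; [rewrite big1 | rewrite muln0 mul0n]. Qed.

(** Some direction is strictly behind its quota for [i.+1] steps and can be taken next: otherwise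
    summing over all directions gives [i.+1 * A <= A * i], which is false. *)
Lemma balanced_step i k : balanced i k ->
  exists w, balanced i.+1 (fun v => k v + (v == w))%N.
Proof.
case=> sk hk.
have [w hw|hall] := pickP (fun w => (A * k w < i.+1 * a w)%N).
  exists w; split.
    rewrite big_split /= sk (bigD1 w) //= eqxx big1 ?addn1 //.
    by move=> v /negbTE ->.
  move=> v; move: (hk v) hw; case: (eqVneq v w) => [-> _ hw|_ hv _].
    by rewrite addn1 mulnS addnC ltn_add2r.
  by rewrite addn0 mulSn; lia.
exfalso; have: (i.+1 * A <= A * \sum_v k v)%N.
  rewrite [leqLHS]big_distrr [leqRHS]big_distrr; apply: leq_sum => v _.
  by rewrite leqNgt hall.
by rewrite sk; nia.
Qed.

(** By the relation, only the deviations [e v] from the ideal counts move the walk. They sum to zero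
    and each is below [A], so a one-sided bound controls their absolute values. *)
Lemma balanced_norm i k : balanced i k -> (norm_inf (\sum_v val v *+ k v)%R <= R)%N.
Proof.
case=> sk hk; apply/norm_inf_leP => j.
pose e v : int := A%:Z * (k v)%:Z - i%:Z * (a v)%:Z.
have sumjE (b : nbh M -> nat) :
    (\sum_v val v *+ b v) ord0 j = \sum_v (b v)%:Z * val v ord0 j.
  rewrite summxE; apply: eq_bigr => v _.
  by rewrite mulmxnE -mulr_natl natz.
have sume : \sum_v e v = 0.
  rewrite sumrB -!mulr_sumr -!(big_morph Posz PoszD (erefl _)) sk mulrC.
  exact: subrr.
have AE : A%:Z * (\sum_v val v *+ k v) ord0 j = \sum_v e v * val v ord0 j.
  rewrite sumjE; under [RHS]eq_bigr do rewrite mulrBl -!mulrA.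
  rewrite sumrB -!mulr_sumr -(sumjE a) a_rel mxE mulr0 subr0.
  by [].
have hsum : \sum_v `|e v| <= (2 * A * theta M)%N%:Z.
  (* For either sign of [e v], the bound [e v < A] gives [|e v| <= 2 A - e v], and the sum of the
     [e v] vanishes. *)
  apply: (@le_trans _ _ (\sum_v (2%:Z * A%:Z - e v))).
    by apply: ler_sum => v _; have := hk v; rewrite /e; nia.
  rewrite sumrB sume subr0 sumr_const -[_ *+ #|_|]mulr_natr natz -!PoszM.
  by rewrite lez_nat leq_mul2l card_nbh_le orbT.
have : `|A%:Z * (\sum_v val v *+ k v) ord0 j| <= (A * R)%N%:Z.
  rewrite AE; apply: (le_trans (ler_norm_sum _ _ _)).
  apply: (@le_trans _ _ (\sum_v `|e v| * (radius M)%:Z)).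
    apply: ler_sum => v _; rewrite normrM ler_wpM2l //.
    by rewrite -abszE lez_nat (leq_trans (norm_inf_ge _ _)) ?radius_ge.
  rewrite -mulr_suml (le_trans (ler_wpM2r _ hsum)) // -PoszM lez_nat.
  by rewrite -!mulnA mulnCA.
by rewrite -abszE lez_nat abszM absz_nat leq_pmul2l.
Qed.

End Walk.

(** * Grains near toppled sites *)

(** The toppling of [x] puts a grain on [x - val v] at time [s + 1], and a site loses grains only by
    toppling itself. *)
Lemma topples_again c x v t s : (s < t)%N ->
    topples (iter s (global_rule M) c) x ->
    iter t (global_rule M) c (x - val v) = 0%N ->
  exists2 s', (s < s' < t)%N & topples (iter s' (global_rule M) c) (x - val v).
Proof.
move=> + tx; elim: t => // t IHt; rewrite ltnS leq_eqVlt.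
case/predU1P=> [<- /= ct0|lt_st ct0]; first by have := global_rule_gt0 v tx; rewrite ct0.
have [tt|ntt] := boolP (topples (iter t (global_rule M) c) (x - val v)).
  by exists t => //; lia.
have [||s' hs' ts'] := IHt => //; last by exists s' => //; lia.
by have := global_rule_ge ntt; move: ct0 => /= ->; rewrite leqn0 => /eqP.
Qed.

(* Along the walk of [balanced_step] the toppling times strictly increase as long
   as no grain is met, so the walk meets a grain before it has made [t] steps. *)
Lemma grain_near_toppled c x t s : (0 < d)%N -> complete M -> (s < t)%N ->
    topples (iter s (global_rule M) c) x ->
  exists2 y, (norm_inf (y - x)%R <= R)%N & (0 < iter t (global_rule M) c y)%N.
Proof.
move=> d0 cM lt_st tx; have [a A0 arel] := complete_relation d0 cM.
pose near := exists2 y,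
  (norm_inf (y - x)%R <= R)%N & (0 < iter t (global_rule M) c y)%N.
have walk i : near \/ exists2 k, balanced a i k & exists2 s', (s + i <= s' < t)%N &
    topples (iter s' (global_rule M) c) (x - \sum_v val v *+ k v).
  elim: i => [|i [?|[k bk [s' hs' ts']]]]; [right|by left|].
    exists (fun=> 0%N); first exact: balanced0.
    by exists s; rewrite ?addn0 ?leqnn // big1 ?subr0.
  have [w bw] := balanced_step A0 bk.
  have ew : x - \sum_v val v *+ (k v + (v == w))%N =
            x - \sum_v val v *+ k v - val w.
    under eq_bigr do rewrite mulrnDr.
    rewrite big_split /= opprD addrA; congr (_ - _).
    rewrite (bigD1 w) //= eqxx mulr1n big1 ?addr0 //.
    by move=> v /negbTE ->; rewrite mulr0n.
  have [ct0|ct_gt0] := posnP (iter t (global_rule M) c (x - \sum_v val v *+ k v - val w)).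
    right; exists (fun v => k v + (v == w))%N => //.
    have [|s'' hs'' ts''] := topples_again _ ts' ct0; first by lia.
    by exists s''; rewrite ?ew //; lia.
  left; exists (x - \sum_v val v *+ k v - val w) => //.
  by rewrite -ew addrC addKr norm_infN; exact: balanced_norm bw.
by have [//|[k _ [s' ? _]]] := walk t; lia.
Qed.

(** * How far grains can spread *)

Lemma grain_source c x t : c x = 0%N -> (0 < iter t (global_rule M) c x)%N ->
  exists2 s, (s < t)%N & exists v, topples (iter s (global_rule M) c) (x + val v).
Proof.
move=> cx0; elim: t => [|t IHt]; first by rewrite /= cx0.
have [ct0 /=|/IHt[s lts hs] _] := posnP (iter t (global_rule M) c x); last first.
  by exists s => //; exact: ltnW.
rewrite global_ruleE ct0 sub0n add0n => sum_gt0; exists t => //.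
have [v hv|none] := pickP (fun v => topples (iter t (global_rule M) c) (x + val v)).
  by exists v.
by move: sum_gt0; rewrite big1 // => v _; rewrite none muln0.
Qed.

(** Trace the grain at [x] back to a toppling neighbor, which itself held grains earlier, and
    repeat. Each hop is at most [radius M] long, so the trace cannot jump over a shell of that
    thickness on its way to the initial support. *)
Lemma toppled_in_shell c n h x t : (0 < theta M)%N ->
    (forall y, (n <= norm_inf y)%N -> c y = 0%N) -> (n <= h)%N ->
    (0 < iter t (global_rule M) c x)%N -> (h + radius M <= norm_inf x)%N ->
  exists2 z, (h <= norm_inf z < h + radius M)%N &
    exists2 s, (s < t)%N & topples (iter s (global_rule M) c) z.
Proof.
move=> th0 c0 le_nh; elim/ltn_ind: t x => t IHt x ct hx.
have [|s lt_st [v tv]] := grain_source (c0 x _) ct; first by lia.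
have hxv : (h <= norm_inf (x + val v)%R)%N.
  have := norm_infD (x + val v) (- val v); rewrite addrK norm_infN.
  by have := radius_ge v; lia.
have [le_h|lt_h] := leqP (h + radius M)%N (norm_inf (x + val v)); last first.
  by exists (x + val v); rewrite ?hxv //; exists s.
have [|z hz [s' lt_s' ts']] := IHt s lt_st _ _ le_h; first exact: leq_trans th0 tv.
by exists z => //; exists s' => //; exact: ltn_trans lt_st.
Qed.

(** A grain further out would put toppled sites in [N + 1] shells, hence grains at [N + 1] distinct
    sites. *)
Lemma grain_extent c n N x t : (0 < d)%N -> complete M -> (0 < theta M)%N ->
    (forall y, (n <= norm_inf y)%N -> c y = 0%N) ->
    (forall l, uniq l -> {in l, forall y, 0 < iter t (global_rule M) c y}%N ->
       (size l <= N)%N) ->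
    (0 < iter t (global_rule M) c x)%N ->
  (norm_inf x < n + N * (radius M + 2 * R) + radius M)%N.
Proof.
move=> d0 cM th0 c0 hN ct; rewrite ltnNge; apply/negP => hx.
(* The spacing is the shell thickness plus a margin [R] on both sides, so the widened shells stay
   disjoint. *)
pose W := (radius M + 2 * R)%N; rewrite -/W in hx.
have shell (j : 'I_N.+1) : exists y, [&& (n + j * W <= norm_inf y + R)%N,
    (norm_inf y < n + j * W + radius M + R)%N & (0 < iter t (global_rule M) c y)%N].
  have [|z hz [s lt_st ts]] := toppled_in_shell th0 c0 (leq_addr (j * W) n) ct.
    by apply: leq_trans hx; rewrite leq_add2r leq_add2l leq_mul2r -ltnS ltn_ord orbT.
  have [y hy cy] := grain_near_toppled d0 cM lt_st ts; exists y; rewrite cy andbT.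
  have := norm_infD (y - z) z; rewrite subrK.
  have := norm_infD (- (y - z)) y; rewrite norm_infN opprB subrK.
  by move: hz hy; lia.
pose f j := xchoose (shell j).
have fP (j : 'I_N.+1) : [/\ (n + j * W <= norm_inf (f j) + R)%N,
    (norm_inf (f j) < n + j * W + radius M + R)%N & (0 < iter t (global_rule M) c (f j))%N].
  exact/and3P/(xchooseP (shell j)).
have lt_f (i j : 'I_N.+1) : (i < j)%N -> f i != f j.
  move=> lt_ij; apply/eqP => eq_f; have [_ h1 _] := fP i; have [h2 _ _] := fP j.
  have : (i.+1 * W <= j * W)%N by rewrite leq_mul2r lt_ij orbT.
  by move: h1 h2; rewrite eq_f mulSn {2}/W; lia.
have inj_f : injective f.
  move=> i j eq_f; apply/val_inj; case: (ltngtP i j) => // /lt_f;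
  by rewrite eq_f eqxx.
have := hN [seq f j | j <- enum 'I_N.+1]; rewrite map_inj_uniq // enum_uniq.
rewrite size_map size_enum_ord ltnn => hf; suff: false by [].
by apply: hf => // y /mapP[j _ ->]; case: (fP j).
Qed.

(** * Weighted grain counts and potentials *)

Lemma sum_shift (S : seq 'rV[int]_d) (f : 'rV[int]_d -> bool)
    (g : 'rV[int]_d -> int) (v : 'rV[int]_d) :
    uniq S -> (forall y, f y -> y \in S /\ y - v \in S) ->
  \sum_(x <- S) (f (x + v))%:Z * g x = \sum_(y <- S) (f y)%:Z * g (y - v).
Proof.
move=> uS hS.
have eqF h (l : seq 'rV[int]_d) :
    \sum_(y <- l) (f y)%:Z * h y = \sum_(y <- [seq y <- l | f y]) h y.
  rewrite big_filter [RHS]big_mkcond; apply: eq_bigr => y _.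
  by case: (f y); rewrite ?mul1r ?mul0r.
transitivity (\sum_(y <- [seq x + v | x <- S]) (f y)%:Z * g (y - v)).
  by rewrite big_map; apply: eq_bigr => x _; rewrite addrK.
rewrite !eqF; apply: perm_big; apply: uniq_perm; rewrite ?filter_uniq //.
  by rewrite map_inj_uniq //; exact: addIr.
move=> y; rewrite !mem_filter; case: (boolP (f y)) => //= /hS[yS yvS].
by rewrite yS; apply/mapP; exists (y - v); rewrite ?subrK.
Qed.

(** Summation by parts: the effect of a step is transferred to the weight [g]. Constant [g] yields
    conservation of grains, a potential [g] yields growth. *)
Lemma sum_global_rule (S : seq 'rV[int]_d) c (g : 'rV[int]_d -> int) :
    (0 < theta M)%N -> uniq S -> (forall x, (0 < c x)%N -> x \in S) ->
    (forall x, (0 < global_rule M c x)%N -> x \in S) ->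
  \sum_(x <- S) (global_rule M c x)%:Z * g x = \sum_(x <- S) (c x)%:Z * g x +
    \sum_(x <- S) (topples c x)%:Z *
      \sum_(v : nbh M) (distr v)%:Z * (g (x - val v) - g x).
Proof.
move=> th0 uS cS FS.
have ruleZ x : (global_rule M c x)%:Z = (c x)%:Z - (theta M)%:Z * (topples c x)%:Z
    + \sum_(v : nbh M) (distr v)%:Z * (topples c (x + val v))%:Z.
  rewrite global_ruleE PoszD (big_morph Posz PoszD (erefl _)) -subzn //.
  by rewrite /topples; case: (leqP (theta M) (c x)) => h; rewrite ?muln1 ?muln0.
have thZ : (theta M)%:Z = \sum_(v : nbh M) (distr v)%:Z.
  by rewrite /theta (big_morph Posz PoszD (erefl _)).
under eq_bigr do rewrite ruleZ mulrDl mulrBl.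
rewrite big_split sumrB /= -addrA; congr (_ + _).
have -> : \sum_(x <- S) (\sum_(v : nbh M) (distr v)%:Z * (topples c (x + val v))%:Z) * g x
    = \sum_(x <- S) \sum_(v : nbh M) (topples c x)%:Z * ((distr v)%:Z * g (x - val v)).
  under eq_bigr do rewrite mulr_suml.
  rewrite exchange_big [RHS]exchange_big; apply: eq_bigr => v _ /=.
  under eq_bigr do rewrite -mulrA.
  under [RHS]eq_bigr do rewrite mulrCA.
  rewrite -!mulr_sumr; congr (_ * _); apply: sum_shift => // y ty; split.
    by apply: cS; exact: leq_trans ty.
  by apply: FS; exact: global_rule_gt0.
rewrite addrC -sumrB; apply: eq_bigr => x _.
under [in RHS]eq_bigr do rewrite mulrBr.
by rewrite sumrB -mulr_suml -mulr_sumr thZ; ring.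
Qed.

(** A single window valid for all times up to [T] lets every sum range over the same list; its size
    is irrelevant. *)
Lemma finite_support_iter c (S0 : seq 'rV[int]_d) T : (0 < theta M)%N ->
    (forall x, (0 < c x)%N -> x \in S0) ->
  exists2 S, uniq S & forall t x, (t <= T)%N ->
    (0 < iter t (global_rule M) c x)%N -> x \in S.
Proof.
move=> th0 cS0; elim: T => [|T [S uS hS]].
  exists (undup S0); first exact: undup_uniq.
  by move=> t x; rewrite leqn0 mem_undup => /eqP->; exact: cS0.
exists (undup (S ++ [seq x - val v | x <- S, v <- enum {: nbh M}])).
  exact: undup_uniq.
move=> t x; rewrite mem_undup mem_cat leq_eqVlt ltnS => /predU1P[->|]; last first.
  by move=> le_tT /(hS _ _ le_tT) ->.
have [cx0|cx_gt0] := posnP (c x); last by rewrite (hS 0%N).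
move=> /(grain_source cx0)[s lt_sT [v tv]]; apply/orP; right.
apply/allpairsP; exists (x + val v, v); rewrite /= addrK mem_enum; split=> //.
by apply: (hS s) => //; exact: leq_trans tv.
Qed.

Lemma complete_nbh : (0 < d)%N -> complete M -> exists v : nbh M, val v != 0.
Proof.
move=> d0 cM; have [a A0 _] := complete_relation d0 cM.
have [v _|none] := pickP (fun _ : nbh M => true).
  by exists v; apply: contraNneq (nbh_neq0 M) => <-; exact: valP.
by move: A0; rewrite big1 // => v; have := none v.
Qed.

(* The squared Euclidean norm works when the drift [m] vanishes; otherwise the
   linear form given by [- m] does. *)
Lemma toppling_potential : (0 < d)%N -> complete M ->
  exists2 phi : 'rV[int]_d -> int,
    forall x, 1 <= \sum_(v : nbh M) (distr v)%:Z * (phi (x - val v) - phi x) &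
    forall x b, (norm_inf x <= b)%N ->
      `|phi x| <= (d * b ^ 2 + d * (theta M * radius M * b))%N%:Z.
Proof.
move=> d0 cM; pose m (j : 'I_d) : int := \sum_(v : nbh M) (distr v)%:Z * val v ord0 j.
have m_le j : `|m j| <= (theta M * radius M)%N%:Z.
  apply: (le_trans (ler_norm_sum _ _ _)).
  rewrite PoszM (big_morph Posz PoszD (erefl _)) mulr_suml; apply: ler_sum => v _.
  rewrite normrM (ger0_norm (le0z_nat _)) ler_wpM2l // -abszE lez_nat.
  exact: leq_trans (norm_inf_ge _ _) (radius_ge v).
have [m0|/forallPn[j0 mj0]] := boolP [forall j, m j == 0]; last first.
  exists (fun x => - \sum_j m j * x ord0 j) => [x|x b hx].
    (* Each toppling gains the squared Euclidean norm of [m], a positive integer. *)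
    have -> : \sum_(v : nbh M) (distr v)%:Z *
        (- (\sum_j m j * (x - val v) ord0 j) - - \sum_j m j * x ord0 j) = \sum_j m j * m j.
      transitivity (\sum_(v : nbh M) \sum_j (distr v)%:Z * (m j * val v ord0 j)).
        apply: eq_bigr => v _; rewrite -mulr_sumr; congr (_ * _).
        rewrite opprK addrC -sumrB; apply: eq_bigr => j _; rewrite int_rowB; ring.
      rewrite exchange_big; apply: eq_bigr => j _ /=.
      rewrite {3}/m mulr_sumr; apply: eq_bigr => v _; ring.
    rewrite (bigD1 j0) //= ler_wpDr ?sumr_ge0 // => [j _|]; first by nia.
    exact: int_mulrr_ge1 mj0.
  rewrite normrN; apply: (le_trans (ler_norm_sum _ _ _)).
  apply: (@le_trans _ _ (\sum_(j < d) (theta M * radius M * b)%N%:Z)).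
    apply: ler_sum => j _; rewrite normrM PoszM ler_pM // -abszE lez_nat.
    exact: leq_trans (norm_inf_ge _ _) hx.
  by rewrite sumr_const card_ord -mulr_natl natz -PoszM lez_nat leq_addl.
have {}m0 j : m j = 0 by exact/eqP/(forallP m0).
exists (fun x => \sum_j x ord0 j * x ord0 j) => [x|x b hx].
  (* Expanding the squares leaves cross terms that add up to minus twice the inner product of [x]
     and [m], which is zero. *)
  have -> : \sum_(v : nbh M) (distr v)%:Z *
      (\sum_j (x - val v) ord0 j * (x - val v) ord0 j - \sum_j x ord0 j * x ord0 j) =
      \sum_(v : nbh M) (distr v)%:Z * \sum_j val v ord0 j * val v ord0 j.
    transitivity (\sum_(v : nbh M) (distr v)%:Z * (\sum_j val v ord0 j * val v ord0 j)
        - 2%:Z * \sum_j x ord0 j * m j); last first.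
      by rewrite [X in _ - _ * X]big1 ?mulr0 ?subr0 // => j _; rewrite m0 mulr0.
    under [X in _ - _ * X]eq_bigr do rewrite /m mulr_sumr.
    rewrite exchange_big /= mulr_sumr -sumrB; apply: eq_bigr => v _.
    rewrite -sumrB !mulr_sumr -sumrB; apply: eq_bigr => j _; rewrite int_rowB; ring.
  have [v0 v0_neq0] := complete_nbh d0 cM.
  have sq_ge0 v : 0 <= \sum_j val v ord0 j * val v ord0 j.
    by apply: sumr_ge0 => j _; nia.
  have [j0 hj0|v0_0] := pickP (fun j => val v0 ord0 j != 0); last first.
    by case/eqP: v0_neq0; apply/rowP => j; rewrite mxE; have /eqP := v0_0 j.
  rewrite (bigD1 v0) //= ler_wpDr ?sumr_ge0 // => [v _|]; first by rewrite mulr_ge0 ?sq_ge0.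
  have : 1 <= \sum_j val v0 ord0 j * val v0 ord0 j.
    rewrite (bigD1 j0) //= ler_wpDr ?sumr_ge0 // => [j _|]; first by nia.
    exact: int_mulrr_ge1 hj0.
  by move/le_trans; apply; rewrite ler_peMl ?sq_ge0 // (lez_nat 1) distr_gt0.
apply: (le_trans (ler_norm_sum _ _ _)).
apply: (@le_trans _ _ (\sum_(j < d) (b ^ 2)%N%:Z)).
  apply: ler_sum => j _; rewrite normrM -mulnn PoszM.
  by apply: ler_pM => //; rewrite -abszE lez_nat; exact: leq_trans (norm_inf_ge _ _) hx.
by rewrite sumr_const card_ord -mulr_natl natz -PoszM lez_nat leq_addr.
Qed.

(** * Bounding the stabilization time *)

Lemma cube_support c n : (0 < n)%N -> supported_on_cube n c ->
  exists2 S : seq 'rV[int]_d, size S = (n ^ d)%N & forall x, (0 < c x)%N -> x \in S.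
Proof.
case: n => // n _ hc.
exists [seq map_mx (fun i : 'I_n.+1 => i%:Z) A | A <- enum {: 'rV['I_n.+1]_d}].
  by rewrite size_map -cardE card_mx card_ord mul1n.
move=> x cx; apply/mapP; exists (\row_j inord `|x ord0 j|); first by rewrite mem_enum.
apply/rowP => j; rewrite !mxE; have := hc x; case: (c x) cx => // k _ /(_ _ j)[]//.
by case/andP=> h1 h2; rewrite inordK -?ltz_nat gez0_abs.
Qed.

(** The total potential lies between [- N * G] and [N * G] and grows by at least 1 in every step
    from an unstable configuration. *)
Lemma stabilization_time c n : (0 < d)%N -> complete M -> (0 < n)%N ->
    supported_on_cube n c -> (forall x, c x < 2 * theta M)%N ->
  let N := (2 * theta M * n ^ d)%N in
  let B := (n + N * (radius M + 2 * R) + radius M)%N in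
  exists2 t, (t <= 2 * N * (d * B ^ 2 + d * (theta M * radius M * B)))%N &
    stable M (iter t (global_rule M) c).
Proof.
move=> d0 cM n0 hc c_lt N B; set G := (_ + d * _)%N.
have [v0 _] := complete_nbh d0 cM.
have th0 : (0 < theta M)%N.
  by rewrite /theta (bigD1 v0) //=; have := distr_gt0 v0; lia.
have [phi phi_step phi_le] := toppling_potential d0 cM.
have c0 y : (n <= norm_inf y)%N -> c y = 0%N.
  move=> le_n; case: (posnP (c y)) => // cy; move: le_n; rewrite leqNgt => /negP[].
  rewrite -(prednK n0) ltnS; apply/norm_inf_leP => i.
  have := hc y; case: (c y) cy => // k _ /(_ _ i)[]//.
  by case/andP=> h1 h2; lia.
have [S0 sS0 cS0] := cube_support n0 hc.
(* One more step than the range of the total potential allows. *)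
pose T := (2 * N * G).+1.
have [S uS hS] := finite_support_iter T th0 cS0.
pose ct t := iter t (global_rule M) c.
have stepS t g : (t < T)%N -> \sum_(x <- S) (ct t.+1 x)%:Z * g x =
    \sum_(x <- S) (ct t x)%:Z * g x + \sum_(x <- S) (topples (ct t) x)%:Z *
      \sum_(v : nbh M) (distr v)%:Z * (g (x - val v) - g x).
  move=> lt_tT; apply: sum_global_rule => // x; first by apply: hS; exact: ltnW.
  exact: (hS t.+1).
have mass t : (t <= T)%N -> (\sum_(x <- S) ct t x <= N)%N.
  elim: t => [_|t IHt lt_tT].
    apply: (@leq_trans (\sum_(x <- S | 0 < c x) (2 * theta M))%N).
      rewrite [leqRHS]big_mkcond; apply: leq_sum => x _ /=.
      by have := c_lt x; case: (c x) => //= k /ltnW.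
    rewrite big_const_seq iter_addn_0 leq_mul2l -sS0 -size_filter; apply/orP; right.
    by apply: uniq_leq_size; rewrite ?filter_uniq // => x; rewrite mem_filter => /andP[/cS0].
  (* With the constant weight 1 the toppling term vanishes. *)
  have := stepS t (fun=> 1) lt_tT; rewrite [X in _ + X]big1 => [|x _]; last first.
    by rewrite big1 ?mulr0 // => v _; rewrite subrr mulr0.
  have sum1 s : \sum_(x <- S) (ct s x)%:Z * 1 = (\sum_(x <- S) ct s x)%N%:Z.
    by rewrite -mulr_suml mulr1 (big_morph Posz PoszD (erefl _)).
  by rewrite addr0 !sum1 => -[->]; apply: IHt; exact: ltnW.
have phiS t : (t <= T)%N -> `|\sum_(x <- S) (ct t x)%:Z * phi x| <= (N * G)%N%:Z.
  move=> le_tT; apply: (le_trans (ler_norm_sum _ _ _)).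
  apply: (@le_trans _ _ (\sum_(x <- S) (ct t x)%:Z * G%:Z)).
    apply: ler_sum => x _; rewrite normrM (ger0_norm (le0z_nat _)).
    case: (posnP (ct t x)) => [->|ctx]; first by rewrite !mul0r.
    rewrite ler_wpM2l // phi_le //; apply: ltnW.
    apply: (grain_extent d0 cM th0 c0 _ ctx) => l ul hl.
    apply: leq_trans (mass t le_tT).
    (* Occupied sites are at most as many as grains. *)
    apply: (@leq_trans (size [seq x <- S | 0 < ct t x]%N)).
      apply: uniq_leq_size => // y yl; rewrite mem_filter hl //=.
      by apply: (hS t) => //; exact: hl.
    rewrite size_filter -sum1_count big_mkcond; apply: leq_sum => y _.
    by case: (ct t y).
  rewrite -mulr_suml -(big_morph Posz PoszD (erefl _)) -PoszM lez_nat.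
  by rewrite leq_mul2r mass ?orbT.
have [t|unst] := pickP (fun t : 'I_T => ~~ has (topples (ct t)) S).
  move=> /hasPn hst; exists t; first by rewrite -ltnS.
  move=> x; rewrite ltnNge; apply/negP => tx.
  have xS : x \in S by apply: (hS t) => //; [exact: ltnW | exact: leq_trans tx].
  by have := hst x xS; rewrite /topples tx.
have grow t : (t <= T)%N -> \sum_(x <- S) (ct 0%N x)%:Z * phi x + t%:Z <=
    \sum_(x <- S) (ct t x)%:Z * phi x.
  elim: t => [_|t IHt lt_tT]; first by rewrite addr0.
  rewrite stepS // -[t.+1]addn1 PoszD addrA; apply: lerD; first by apply: IHt; exact: ltnW.
  have /negbFE/hasP[y yS ty] := unst (Ordinal lt_tT).
  rewrite (big_rem y) //= ty mul1r ler_wpDr ?phi_step // sumr_ge0 // => x _.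
  by rewrite mulr_ge0 // (le_trans _ (phi_step x)).
have := grow T (leqnn T); have := phiS 0%N isT; have := phiS T (leqnn T).
by rewrite /T; lia.
Qed.

End Toppling.

(** * Absorbing all constants into a power of [X] *)

Lemma stabilization_time_le_exp d th r n N B X :
    0 < d -> 0 < th -> 0 < r -> 0 < n -> X = 2 * d * th * r * n ->
    N = 2 * th * n ^ d -> B = n + N * (r + 2 * (2 * th * r)) + r ->
  2 * N * (d * B ^ 2 + d * (th * r * B)) <= X ^ (19 * d ^ 2).
Proof.
move=> d0 th0 r0 n0 eX eN eB.
have X2 : 2 <= X by rewrite eX -!mulnA leq_pmulr // !muln_gt0 d0 th0 r0.
have nX : n <= X by rewrite eX leq_pmull // !muln_gt0 d0 th0 r0.
have rX : r <= X by rewrite eX mulnAC leq_pmull // !muln_gt0 d0 th0 n0.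
have thX : 2 * th <= X.
  by rewrite eX (_ : _ * n = d * r * n * (2 * th)) ?leq_pmull ?muln_gt0 ?d0 ?r0 //; lia.
have thrX : 2 * th * r <= X.
  by rewrite eX (_ : _ * n = d * n * (2 * th * r)) ?leq_pmull ?muln_gt0 ?d0 //; lia.
have dthrX : d * (th * r) <= X.
  by rewrite eX (_ : _ * n = 2 * n * (d * (th * r))) ?leq_pmull ?muln_gt0 //; lia.
have dX : d <= X.
  by rewrite eX (_ : _ * n = 2 * th * r * n * d) ?leq_pmull ?muln_gt0 ?th0 ?r0 //; lia.
have X0 : 0 < X by exact: ltnW.
have NX : N <= X ^ d.+1 by rewrite eN expnS leq_mul ?leq_exp2r.
have X4 : 4 <= X ^ 2 by rewrite (leq_exp2r 2 X (ltn0Sn 1)).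
have WX : r + 2 * (2 * th * r) <= X ^ 3.
  rewrite expnSr; apply: (@leq_trans (4 * X)); first by lia.
  by rewrite leq_mul2r X4 orbT.
have BX : B <= X ^ (d + 6).
  have h : N * (r + 2 * (2 * th * r)) <= X ^ (d + 4).
    by rewrite (_ : d + 4 = d.+1 + 3) ?expnD ?leq_mul //; lia.
  have h1 : X <= X ^ (d + 4) by rewrite -{1}(expn1 X) leq_pexp2l //; lia.
  rewrite eB (_ : d + 6 = d + 4 + 2) ?[X ^ (_ + 2)]expnD; last by lia.
  apply: (@leq_trans (X ^ (d + 4) * 4)); first by lia.
  by rewrite leq_mul2l X4 orbT.
have SX : d * B ^ 2 + d * (th * r * B) <= X ^ (d + 6 + (d + 6) + 2).
  have hB : B <= B ^ 2 by rewrite -mulnn; nia.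
  have hB2 : B ^ 2 <= X ^ (d + 6 + (d + 6)) by rewrite -mulnn expnD leq_mul.
  rewrite expnD -[X ^ 2]mulnn; apply: (@leq_trans (X * B ^ 2 + X * B ^ 2)).
    by rewrite [d * (_ * B)]mulnA leq_add ?leq_mul.
  rewrite addnn -mul2n mulnA [leqRHS]mulnC.
  by rewrite leq_mul // leq_mul2r X2 orbT.
(* The exponent equals [3 * d + 16], which is at most [19 * d ^ 2] for positive [d]; this is the
   source of 19. *)
apply: (@leq_trans (X ^ (1 + d.+1 + (d + 6 + (d + 6) + 2)))).
  by rewrite expnD leq_mul // expnD expn1 leq_mul.
by rewrite leq_pexp2l //; nia.
Qed.

Theorem theorem1 :
  exists K : nat,
    forall (d : nat) (M : sandpile d), complete M ->
    forall n : nat, 1 <= n ->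
    forall c : configuration d,
      supported_on_cube n c ->
      (forall x, c x < 2 * theta M) ->
      exists2 t : nat,
        t <= (2 * d * theta M * radius M * n) ^ (K * d ^ 2) &
        stable M (iter t (global_rule M) c).
Proof.
exists 19 => d M cM n n0 c hc c_lt.
(* In dimension 0 the only vector is 0, so the neighborhood is empty, [theta M = 0], and no [c]
   satisfies the bound. *)
have [d_eq0|d0] := posnP d.
  have : theta M = 0.
    rewrite /theta big1 // => v _; case/negP: (nbh_neq0 M).
    suff <- : val v = 0%R by exact: valP.
    by apply/rowP => i; have := ltn_ord i; rewrite {2}d_eq0.
  by have := c_lt 0%R => /[swap] ->; rewrite muln0.
have [v0 v0_neq0] := complete_nbh d0 cM.
have th0 : 0 < theta M.
  by apply: leq_trans (card_nbh_le M); apply/card_gt0P; exists v0.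
have r0 : 0 < radius M.
  apply: leq_trans (radius_ge v0); rewrite lt0n; apply: contra v0_neq0 => /eqP nv0.
  apply/eqP/rowP => i; rewrite mxE; apply/eqP; rewrite -absz_eq0 -leqn0.
  by rewrite -[leqRHS]nv0 norm_inf_ge.
have [t ht st] := stabilization_time d0 cM n0 hc c_lt.
exists t => //; apply: leq_trans ht _.
exact: stabilization_time_le_exp d0 th0 r0 n0 erefl erefl erefl.
Qed.
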